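(* Let $\mathcal P$ be a collection of probability measures on a measurable space $(\Omega,\mathcal F)$, and let $(E_n)_{n=1}^\infty$ be events in $\mathcal F$ that are independent under every $P\in\mathcal P$ and such that $$0<\lim_{m\to\infty}\sup_{P\in\mathcal P}\sum_{k=m}^\infty P(E_k)\le\infty.$$ Then $$\lim_{m\to\infty}\sup_{P\in\mathcal P}P\left(\bigcup_{k=m}^\infty E_k\right)>0.$$
   Context: The sums $\sum_{k=m}^\infty P(E_k)$ and their suprema take values in $[0,\infty]$. *)

(* Defs.v *)
From HB Require Import structures.
From mathcomp Require Export all_boot all_order all_algebra finmap.
From mathcomp Require Export all_classical all_reals all_analysis.

Set Implicit Arguments.
Unset Strict Implicit.
Unset Printing Implicit Defensive.

Local Open Scope classical_set_scope.
Local Open Scope ereal_scope.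

(* Mutual independence (not merely pairwise); the product is taken in \bar R. *)
Definition mutually_independent (d : measure_display) (Omega : measurableType d)
    (R : realType) (P : probability Omega R) (E : nat -> set Omega) : Prop :=
  forall J : {fset nat},
    P (\bigcap_(i in [set` J]) E i) = \prod_(i <- J) P (E i).

(* Main.v *)
Require Import Defs.
From mathcomp Require Import ring lra.

(** Independence turns a large sum of probabilities into a large union.
    If [p_k] is the probability of [E_k] and [s] is a finite set of indices,
    independence of the complements gives that none of the [E_k], [k] in [s],
    occurs with probability [prod (1 - p_k)].  Since [(1 - p) (1 + p) <= 1] and
    [prod (1 + p_k) >= 1 + sum p_k], this is at most [1 / (1 + sum p_k)], so the
    union over [s] has probability at least [c / (1 + c)] whenever
    [c <= sum p_k] ([prob_bigU_ge]).  This bound does not depend on the measure.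

    The suprema of the tail sums decrease with [m], so all of them are at least
    their positive limit.  Fix a real [c > 0] below that limit: for every [m],
    some [P] in the collection has a tail sum from [m] exceeding [c], hence
    already a finite partial sum exceeding [c], hence gives the tail union from
    [m] a probability at least [c / (1 + c)].  The limit of the suprema of these
    probabilities is therefore at least [c / (1 + c)] as well. *)

Set Implicit Arguments.
Unset Strict Implicit.
Unset Printing Implicit Defensive.

Import Order.TTheory GRing.Theory Num.Theory.
Import numFieldNormedType.Exports.

Local Open Scope classical_set_scope.
Local Open Scope ring_scope.

(** The product is at most [1 / (1 + sum p)]; clearing the denominator gives a
    form that goes through by induction, as
    [(1 - p) (1 + p + S) <= 1 + S] for [p, S >= 0]. *)
Lemma prod_onem_mul_sum_le1 (R : realFieldType) (I : Type) (s : seq I)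
    (p : I -> R) (p01 : forall i, 0 <= p i <= 1) :
  \prod_(i <- s) (1 - p i) * (1 + \sum_(i <- s) p i) <= 1.
Proof.
elim: s => [|i s IH]; first by rewrite !big_nil addr0 mulr1.
rewrite !big_cons.
have /andP[p0 p1] := p01 i.
have S0 : 0 <= \sum_(j <- s) p j.
  by apply: sumr_ge0 => j _; case/andP: (p01 j).
have Q0 : 0 <= \prod_(j <- s) (1 - p j).
  by apply: prodr_ge0 => j _; rewrite subr_ge0; case/andP: (p01 j).
move: IH S0 Q0; set S := \sum_(_ <- _) _; set Q := \prod_(_ <- _) _.
move=> IH S0 Q0; apply: le_trans IH.
rewrite mulrAC mulrC ler_wpM2l//.
have pS0 : 0 <= p i * S by exact: mulr_ge0.
have pp0 : 0 <= p i * p i by exact: mulr_ge0.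
nra.
Qed.

Section independence.
Context (R : realType) (d : measure_display) (Omega : measurableType d).
Context (P : probability Omega R) (E : nat -> set Omega).
Hypothesis mE : forall n, measurable (E n).
Hypothesis indE : mutually_independent P E.

Let p i := fine (P (E i)).

Let p01 i : 0 <= p i <= 1.
Proof.
rewrite fine_ge0//= -lee_fin fineK ?fin_num_measure//.
exact: probability_le1.
Qed.

(** Carrying the intersection over [J] makes the induction on [s] work:
    removing [E i] from an event subtracts the same kind of probability with
    [i] moved into [J]. *)
Lemma prob_bigcap_setD_bigU (s : seq nat) (J : {fset nat}) :
  uniq s -> {in s, forall i, i \notin J} ->
  fine (P (\bigcap_(i in [set` J]) E i `\` \big[setU/set0]_(i <- s) E i)) =
  \prod_(i <- J) p i * \prod_(i <- s) (1 - p i).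
Proof.
have mI (K : {fset nat}) : measurable (\bigcap_(i in [set` K]) E i).
  exact: fin_bigcap_measurable.
have mU (t : seq nat) : measurable (\big[setU/set0]_(i <- t) E i).
  exact: bigsetU_measurable.
elim: s J => [|i s IH] J /=.
  move=> _ _; rewrite !big_nil setD0 mulr1 indE.
  have -> : (\prod_(i <- J) P (E i) = (\prod_(i <- J) p i)%:E)%E.
    rewrite -prodEFin; apply: eq_bigr => i _.
    by rewrite fineK ?fin_num_measure.
  by [].
move=> /andP[is_ us] sJ.
have iJ : i \notin J by apply: sJ; rewrite mem_head.
rewrite !big_cons setUC -setDDl measureD//; last 2 first.
- exact: measurableD.
- by rewrite ltey_eq fin_num_measure//; exact: measurableD.
rewrite fineB ?fin_num_measure//; last 2 first.
- exact: measurableD.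
- by apply: measurableI => //; exact: measurableD.
have -> : (\bigcap_(i in [set` J]) E i `\` \big[setU/set0]_(i <- s) E i) `&` E i
    = \bigcap_(i in [set` (i |` J)%fset]) E i `\` \big[setU/set0]_(i <- s) E i.
  by rewrite set_fsetU1 bigcap_setU1 setIC setIDA.
rewrite !IH//.
- by rewrite big_fsetU1//=; ring.
- move=> j js; rewrite in_fset1U negb_or sJ ?inE ?js ?orbT// andbT.
  by apply: contraNneq is_ => <-.
- by move=> j js; apply: sJ; rewrite inE js orbT.
Qed.

(** The complement of the union has probability [prod (1 - p)], and
    [prod (1 - p) * (1 + c) <= 1]; the resulting bound is uniform in [P]. *)
Lemma prob_bigU_ge (s : seq nat) (c : R) : uniq s ->
  0 < c -> c <= \sum_(i <- s) p i ->
  ((c / (1 + c))%:E <= P (\big[setU/set0]_(i <- s) E i))%E.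
Proof.
move=> us c0 cS.
have mU : measurable (\big[setU/set0]_(i <- s) E i).
  exact: bigsetU_measurable.
have := prob_bigcap_setD_bigU (J := fset0) us (fun=> fun=> isT).
rewrite set_fset0 bigcap_set0 big_seq_fset0 mul1r setTD probability_setC//.
rewrite fineB ?fin_num_measure//= => PU.
rewrite -[leRHS]fineK ?fin_num_measure// lee_fin ler_pdivrMr; last by lra.
have := prod_onem_mul_sum_le1 s p01; rewrite -PU.
set x := fine (P _) => xS.
have x1 : x <= 1.
  by rewrite -lee_fin fineK ?fin_num_measure//; exact: probability_le1.
have : (1 - x) * (1 + c) <= (1 - x) * (1 + \sum_(i <- s) p i).
  by rewrite ler_wpM2l ?subr_ge0// lerD2l.
lra.
Qed.

End independence.

Local Open Scope ereal_scope.

Theorem lemma2 (R : realType) (d : measure_display) (Omega : measurableType d)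
    (PP : set (probability Omega R)) (E : nat -> set Omega)
    (mE : forall n : nat, measurable (E n))
    (indE : forall P : probability Omega R, PP P -> mutually_independent P E)
    (limE : 0 < limn (fun m : nat =>
        ereal_sup [set \sum_(m <= k <oo) P (E k) | P in PP]) <= +oo) :
  0 < limn (fun m : nat =>
        ereal_sup [set P (\bigcup_(k in [set k : nat | (m <= k)%N]) E k) | P in PP]).
Proof.
have mtail m : measurable (\bigcup_(k in [set k : nat | (m <= k)%N]) E k).
  exact: bigcup_measurable.
move: limE; set S := fun m : nat => ereal_sup _; set V := fun m : nat => ereal_sup _.
have S_noninc : nonincreasing_seq S.
  move=> n m nm; apply: ge_ereal_sup => _ [P PPP <-].
  apply: (le_trans _ (ereal_sup_ubound _)); last by exists P.
  by rewrite (nneseries_split n (m - n))// subnKC// leeDr// sume_ge0.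
have V_noninc : nonincreasing_seq V.
  move=> n m nm; apply: ge_ereal_sup => _ [P PPP <-].
  apply: (le_trans _ (ereal_sup_ubound _)); last by exists P.
  apply: le_measure; rewrite ?inE//.
  by apply: bigcup_subset => k /=; exact: leq_trans.
rewrite (cvg_lim _ (ereal_nonincreasing_cvgn S_noninc))// => /andP[S_gt0 _].
have [c c0 cS] : exists2 c : R, (0 < c)%R & forall m, c%:E < S m.
  (* The limit may be [+oo], hence the passage to a real [c] below it. *)
  have [c c0 cinf] : exists2 c : R, (0 < c)%R &
      c%:E < ereal_inf (S @` setT).
    move: S_gt0; case: ereal_inf => [r| |]//.
      by rewrite lte_fin => r0; exists (r / 2)%R; rewrite ?lte_fin; lra.
    by move=> _; exists 1%R; rewrite ?ltry.
  exists c => // m; apply: lt_le_trans cinf _.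
  by apply: ereal_inf_lbound; exists m.
apply: (@lt_le_trans _ _ (c / (1 + c))%:E).
  by rewrite lte_fin divr_gt0//; lra.
apply: lime_ge; first exact: ereal_nonincreasing_is_cvgn.
apply: nearW => m.
have [_ [P PPP <-] cP] := ereal_sup_gt (cS m).
(* A series of nonnegative terms is the supremum of its partial sums. *)
have [N cN] : exists N, c%:E < \sum_(m <= k < N) P (E k).
  apply/not_existsP => Nc; move: cP; apply/negP; rewrite -leNgt.
  apply: lime_le; first exact: is_cvg_nneseries.
  by apply: nearW => N; rewrite leNgt; exact/negP.
apply: (le_trans _ (ereal_sup_ubound _)); last by exists P.
apply: (@le_trans _ _ (P (\big[setU/set0]_(k <- index_iota m N) E k))).
  apply: prob_bigU_ge => //; [exact: indE|exact: iota_uniq|].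
  rewrite -lee_fin -sumEFin; apply/ltW; move: cN; congr (_ < _).
  by apply: eq_bigr => k _; rewrite fineK ?fin_num_measure.
apply: le_measure; rewrite ?inE//; first exact: bigsetU_measurable.
rewrite -bigcup_seq; apply: bigcup_subset => k /=.
by rewrite mem_index_iota => /andP[].
Qed.
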